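(* If $\diamondsuit$ holds, then there is a Souslin tree $T$ with the unique branch property which is not absolutely rigid; indeed, $1\Vdash_T$ ''$T$ is not rigid''.
   Context: $\diamondsuit$: there is $\langle D_\alpha:\alpha<\omega_1\rangle$ with $D_\alpha\subseteq\alpha$ such that for all $A\subseteq\omega_1$, $\{\alpha:A\cap\alpha=D_\alpha\}$ is stationary. A Souslin tree is a normal $\omega_1$-tree (countable levels, every node has at least two immediate successors, limit nodes determined by predecessors, every node has successors at every higher level) with no uncountable antichain. Forcing with a tree uses the reversed order. $T$ has the unique branch property if $1\Vdash_T$ ''$T$ has exactly one new cofinal branch''; $T$ is rigid if it has no nontrivial automorphism, and absolutely rigid if $1\Vdash_T$ ''$T$ is rigid''. *)

(* Defs.v *)
From mathcomp Require Import all_boot.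
From mathcomp Require Import boolp classical_sets cardinality.
Set Implicit Arguments.
Unset Strict Implicit.
Unset Printing Implicit Defensive.

Local Open Scope classical_set_scope.

Definition strict_order T (lt : T -> T -> Prop) : Prop :=
  (forall x, ~ lt x x) /\ (forall x y z, lt x y -> lt y z -> lt x z).

Definition well_orders T (lt : T -> T -> Prop) (A : set T) : Prop :=
  (forall x y, A x -> A y -> [\/ lt x y, x = y | lt y x]) /\
  (forall B : set T, B `<=` A -> B !=set0 ->
     exists2 m, B m & forall x, B x -> m = x \/ lt m x).

(** [W], ordered by [lt], has order type omega_1: it is an uncountable
    well-order all of whose proper initial segments are countable. Elements of
    [W] play the role of the countable ordinals. *)
Definition is_omega1 (W : Type) (lt : W -> W -> Prop) : Prop :=
  [/\ strict_order lt,
      well_orders lt [set: W],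
      ~ countable [set: W]
    & forall a : W, countable [set b | lt b a]].

Definition limit_ordinal W (lt : W -> W -> Prop) (a : W) : Prop :=
  (exists b, lt b a) /\ (forall b, lt b a -> exists2 c, lt b c & lt c a).

Definition unbounded W (lt : W -> W -> Prop) (C : set W) : Prop :=
  forall a, exists2 b, C b & lt a b.

Definition closed_in_omega1 W (lt : W -> W -> Prop) (C : set W) : Prop :=
  forall a, limit_ordinal lt a ->
    (forall b, lt b a -> exists c, [/\ C c, lt b c & lt c a]) -> C a.

Definition club W (lt : W -> W -> Prop) (C : set W) : Prop :=
  closed_in_omega1 lt C /\ unbounded lt C.

Definition stationary W (lt : W -> W -> Prop) (S : set W) : Prop :=
  forall C, club lt C -> S `&` C !=set0.

Definition diamond W (lt : W -> W -> Prop) : Prop :=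
  exists D : W -> set W,
    (forall a, D a `<=` [set b | lt b a]) /\
    (forall A : set W, stationary lt [set a | A `&` [set b | lt b a] = D a]).

Record tree := Tree {
  node :> Type;
  tlt : node -> node -> Prop;
  troot : node;
  tlt_strict : strict_order tlt;
  tlt_wo : forall x, well_orders tlt [set y | tlt y x];
  trootP : forall x, troot = x \/ tlt troot x
}.

Definition tle (T : tree) (x y : T) : Prop := x = y \/ tlt x y.

Definition tcomparable (T : tree) (x y : T) : Prop := tle x y \/ tle y x.

(** The predecessors of [x] are order-isomorphic to the initial segment of [W]
    below [a]; that is, [x] lies on level [a]. *)
Definition on_level W (lt : W -> W -> Prop) (T : tree) (x : T) (a : W) : Prop :=
  exists f : T -> W,
    (forall y z, tlt y x -> tlt z x -> (tlt y z <-> lt (f y) (f z))) /\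
    f @` [set y | tlt y x] = [set b | lt b a].

Definition immediate_succ (T : tree) (x y : T) : Prop :=
  tlt x y /\ ~ (exists2 z, tlt x z & tlt z y).

(** The first two clauses say that the height of [T] is omega_1. *)
Record normal_omega1_tree W (lt : W -> W -> Prop) (T : tree) : Prop := {
  node_on_level : forall x : T, exists a, on_level lt x a;
  level_nonempty : forall a, exists x : T, on_level lt x a;
  level_countable : forall a, countable [set x : T | on_level lt x a];
  two_immediate_succ : forall x : T,
    exists y z, [/\ y <> z, immediate_succ x y & immediate_succ x z];
  limit_nodes : forall (a : W) (x y : T),
    limit_ordinal lt a -> on_level lt x a -> on_level lt y a ->
    [set z | tlt z x] = [set z | tlt z y] -> x = y;
  higher_succ : forall (a b : W) (x : T),
    on_level lt x a -> lt a b -> exists2 y, tlt x y & on_level lt y b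
}.

Definition antichain (T : tree) (A : set T) : Prop :=
  forall x y, A x -> A y -> x <> y -> ~ tcomparable x y.

Definition souslin W (lt : W -> W -> Prop) (T : tree) : Prop :=
  normal_omega1_tree lt T /\
  (forall A : set T, antichain A -> countable A).

Record forcing := Forcing {
  cond :> Type;
  stronger : cond -> cond -> Prop;
  one : cond;
  stronger_refl : forall p, stronger p p;
  stronger_trans : forall p q r,
    stronger p q -> stronger q r -> stronger p r;
  stronger_one : forall p, stronger p one
}.

(** A sentence of the forcing language is represented by the set of conditions
    forcing it: for [phi : fprop P] and [p : P], [phi p] reads "p forces phi".
    The clauses are the usual recursive ones for negation, conjunction and
    universal quantification; the other connectives are abbreviations. *)
Definition fprop (P : forcing) := P -> Prop.

Definition fnot P (phi : fprop P) : fprop P :=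
  fun p => forall q, stronger q p -> ~ phi q.
Definition fand P (phi psi : fprop P) : fprop P :=
  fun p => phi p /\ psi p.
Definition fall P (X : Type) (phi : X -> fprop P) : fprop P :=
  fun p => forall x, phi x p.

Definition for_ P (phi psi : fprop P) := fnot (fand (fnot phi) (fnot psi)).
Definition fimp P (phi psi : fprop P) := fnot (fand phi (fnot psi)).
Definition fiff P (phi psi : fprop P) := fand (fimp phi psi) (fimp psi phi).
Definition fex P (X : Type) (phi : X -> fprop P) :=
  fnot (fall (fun x => fnot (phi x))).

(** Absolute (atomic) statements about check names of ground-model objects. *)
Definition fcheck P (A : Prop) : fprop P := fun=> A.

(** A name for a subset of the ground-model set [X]: a set of pairs of (the
    check name of) an element of [X] and a condition. Every subset of [X] in a
    generic extension has such a name, so that quantification over [P(X)] in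
    the forcing language is [fall]/[fex] over [name P X]; quantification over
    [X] itself, or over a ground-model power set, is [fall]/[fex] over the
    corresponding ground type. *)
Definition name (P : forcing) (X : Type) := set (X * P).

Definition check_name P X (B : set X) : name P X := [set xp | B xp.1].
Arguments check_name P {X} B.

(** [p] forces [x] into [A] when the conditions below some [s] with
    [(x, s)] in [A] are dense below [p]. *)
Definition fmem P X (x : X) (A : name P X) : fprop P :=
  fun p => forall q, stronger q p ->
    exists2 r, stronger r q & exists2 s, A (x, s) & stronger r s.

Declare Scope forcing_scope.
Delimit Scope forcing_scope with F.
Bind Scope forcing_scope with fprop.
Notation "~ A" := (fnot A) : forcing_scope.
Notation "A /\ B" := (fand A B) : forcing_scope.
Notation "A \/ B" := (for_ A B) : forcing_scope.
Notation "A ==> B" := (fimp A B) : forcing_scope.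
Notation "A <-> B" := (fiff A B) : forcing_scope.
Notation "\all x .. y , A" := (fall (fun x => .. (fall (fun y => A%F)) ..))
  (at level 200, x binder, y binder, right associativity) : forcing_scope.
Notation "\ex x .. y , A" := (fex (fun x => .. (fex (fun y => A%F)) ..))
  (at level 200, x binder, y binder, right associativity) : forcing_scope.
Notation "x \inn A" := (fmem x A) (at level 50) : forcing_scope.
Notation "'⌜' A '⌝'" := (@fcheck _ A%type) (at level 0) : forcing_scope.

Definition feq P X (A B : name P X) : fprop P :=
  (\all x : X, x \inn A <-> x \inn B)%F.

Definition fnew P X (A : name P X) : fprop P :=
  (\all B : set X, ~ feq A (check_name P B))%F.

Definition one_forces P (phi : fprop P) : Prop := phi (one P).

Lemma tle_refl (T : tree) (x : T) : tle x x.
Proof. by left. Qed.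

Lemma tge_trans (T : tree) (x y z : T) : tle y x -> tle z y -> tle z x.
Proof.
move=> [->|yx] [->|zy]; [by left|by right|by right|right].
by case: (tlt_strict T) => _ tr; exact: tr zy yx.
Qed.

(** Reversed order: extending a condition is going up in the tree. *)
Definition tree_forcing (T : tree) : forcing :=
  @Forcing T (fun q p => tle p q) (troot T)
    (@tle_refl T) (@tge_trans T) (@trootP T).

(** A cofinal branch is a maximal chain meeting every level; levels are absolute
    and so are computed in the ground model. *)
Definition fcofinal_branch W (lt : W -> W -> Prop) (T : tree) (P : forcing)
    (b : name P T) : fprop P :=
  ((\all x y : T, (x \inn b /\ y \inn b) ==> ⌜tcomparable x y⌝) /\
   (\all x : T, (\all y : T, y \inn b ==> ⌜tcomparable x y⌝) ==> x \inn b) /\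
   (\all a : W, \ex x : T, ⌜on_level lt x a⌝ /\ x \inn b))%F.

Definition fexactly_one_new_cofinal_branch W (lt : W -> W -> Prop) (T : tree)
    (P : forcing) : fprop P :=
  (\ex b : name P T,
     (fcofinal_branch lt b /\ fnew b) /\
     (\all c : name P T,
        (fcofinal_branch lt c /\ fnew c) ==> feq c b))%F.
Arguments fexactly_one_new_cofinal_branch {W} lt T P.

Definition unique_branch_property W (lt : W -> W -> Prop) (T : tree) : Prop :=
  one_forces (fexactly_one_new_cofinal_branch lt T (tree_forcing T)).

(** [F] names the graph of an automorphism. *)
Definition fautomorphism (T : tree) (P : forcing) (F : name P (T * T)) :
    fprop P :=
  ((\all x : T, \ex y : T, (x, y) \inn F) /\
   (\all x y z : T, ((x, y) \inn F /\ (x, z) \inn F) ==> ⌜y = z⌝) /\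
   (\all y : T, \ex x : T, (x, y) \inn F) /\
   (\all x y z : T, ((x, z) \inn F /\ (y, z) \inn F) ==> ⌜x = y⌝) /\
   (\all x x' y y' : T, ((x, y) \inn F /\ (x', y') \inn F) ==>
      (⌜tlt x x'⌝ <-> ⌜tlt y y'⌝)))%F.

Definition ftrivial (T : tree) (P : forcing) (F : name P (T * T)) : fprop P :=
  (\all x : T, (x, x) \inn F)%F.

Definition frigid (T : tree) (P : forcing) : fprop P :=
  (~ (\ex F : name P (T * T), fautomorphism F /\ ~ ftrivial F))%F.
Arguments frigid T P : clear implicits.

Definition absolutely_rigid (T : tree) : Prop :=
  one_forces (frigid T (tree_forcing T)).

(* Main.v *)
From mathcomp Require Import all_boot all_algebra ring.
From mathcomp Require Import boolp classical_sets functions cardinality.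
Require Import Defs.
Set Implicit Arguments.
Unset Strict Implicit.
Unset Printing Implicit Defensive.
Import GRing.Theory.

Local Open Scope classical_set_scope.

(** Level [a] of the tree is a countable affine subspace [L a] of the functions
    from the predecessors of [a] to the rationals; nodes are ordered by
    restriction. Successor levels consist of all extensions. At a limit [l] the
    level is the affine span of countably many branches that are mutually
    generic for the relation [E] on pairs of nodes guessed by diamond at [l].
    An affine change of coordinates turns any two distinct points of the span
    into two of the generating branches, so that every pair of distinct nodes
    of level [l] passes through [E] whenever [E] is dense below [l].

    Applied to a relation coming from an antichain, this bounds the antichain.
    Applied to the pairs [(x, y)] such that [x] forces into a named cofinal
    branch a node off [y], it shows that the branch cannot leave the generic
    one: this is the unique branch property. Finally, levels being affine, the
    point reflections [x |-> 2 s - x] with centres [s] on the generic branch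
    cohere to an automorphism of the tree, which is nontrivial as it moves every
    node off that branch. *)

(** * Countable sets, generic sequences and well-founded recursion *)

Lemma countable_range (T : Type) (A : set T) :
  countable A -> A !=set0 -> exists f : nat -> T, range f = A.
Proof.
move=> cA A0; have /pfcard_geP[A_eq0|[f]] := cA.
  by case: A0 => x; rewrite A_eq0.
by exists f; apply: image_eq.
Qed.

Lemma countable_image (T U : Type) (f : T -> U) (A : set T) :
  countable A -> countable (f @` A).
Proof. by move=> cA; apply: sub_countable cA; exact: card_image_le. Qed.

Lemma countable_sub (T : Type) (A B : set T) :
  A `<=` B -> countable B -> countable A.
Proof. by move=> AB cB; apply: sub_countable cB; exact: subset_card_le. Qed.

(** The Rasiowa-Sikorski construction: stage [n] meets the requirement with code [n], if there is
    one. *)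
Lemma generic_sequence (P : Type) (C : set P) (ext : P -> P -> Prop)
    (I : countType) (D : I -> set P) (p0 : P) :
  (forall p, C p -> ext p p) ->
  (forall p q r, ext p q -> ext q r -> ext p r) ->
  (forall i p, C p -> exists q, [/\ C q, ext p q & D i q]) ->
  C p0 ->
  exists s : nat -> P, [/\ forall n, C (s n),
    forall m n, m <= n -> ext (s m) (s n) & forall i, exists n, D i (s n)].
Proof.
move=> extxx ext_trans dense Cp0.
have step : forall np : nat * P, exists q, C np.2 ->
    [/\ C q, ext np.2 q & forall i, unpickle np.1 = Some i -> D i q].
  move=> [n p] /=; have [Cp|nCp] := pselect (C p); last by exists p.
  case: (unpickle n) => [i|]; last by exists p => _; split=> //; exact: extxx.
  have [q [Cq pq Dq]] := dense i p Cp.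
  by exists q => _; split=> // j [<-].
have [f fP] := choice step.
pose s := fix s n := if n is m.+1 then f (m, s m) else p0.
have Cs n : C (s n) by elim: n => //= n IHn; have [] := fP (n, s n) IHn.
exists s; split=> //.
- move=> m n; elim: n => [|n IHn].
    by rewrite leqn0 => /eqP->; exact: extxx.
  rewrite leq_eqVlt => /orP[/eqP->|]; first exact: extxx.
  rewrite ltnS => /IHn smn.
  by apply: ext_trans smn _; have [] := fP (n, s n) (Cs n).
- move=> i; exists (pickle i).+1 => /=.
  have [_ _] := fP (pickle i, s (pickle i)) (Cs _).
  by apply; rewrite pickleK.
Qed.

(** Transfinite recursion where a choice at [a] is only guaranteed once the earlier choices are
    correct. Locality of [R] allows values outside the segment below [a] to be replaced by the
    default [x0]. *)
Lemma wf_recursive_choice (W X : Type) (lt : W -> W -> Prop) (x0 : X)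
    (R : W -> (W -> X) -> X -> Prop) :
  well_founded lt ->
  (forall a P Q x, (forall b, lt b a -> P b = Q b) -> R a P x -> R a Q x) ->
  (forall a P, (forall b, lt b a -> R b P (P b)) -> exists x, R a P x) ->
  exists P, forall a, R a P (P a).
Proof.
move=> wf local step.
have ex_pick (aP : W * (W -> X)) :
    exists x, (exists x, R aP.1 aP.2 x) -> R aP.1 aP.2 x.
  have [[x Rx]|nR] := pselect (exists x, R aP.1 aP.2 x); first by exists x.
  by exists x0.
have [pick pickP] := choice ex_pick.
pose F a (rec : forall b, lt b a -> X) := pick (a, fun b =>
  if pselect (lt b a) is left h then rec b h else x0).
pose P := Fix wf (fun=> X) F.
have PE a : P a = pick (a, fun b => if pselect (lt b a) then P b else x0).
  rewrite /P Fix_eq; last first.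
    move=> b f g fg; rewrite /F; congr (pick (_, _)); apply/funext => c.
    by case: pselect.
  rewrite /F; congr (pick (_, _)); apply/funext => c.
  by case: pselect.
exists P => a; elim/(well_founded_ind wf): a => a IHa; rewrite PE.
have cutE b : lt b a -> P b = if pselect (lt b a) then P b else x0.
  by move=> ba; case: pselect.
apply: (local a (fun b => if pselect (lt b a) then P b else x0)).
  by move=> b /cutE.
apply: (pickP (a, _)) => /=.
have [x Rx] := step a P IHa.
by exists x; apply: local Rx; exact: cutE.
Qed.

(** * Rules for the forcing relation *)

Section Forcing.
Variable P : forcing.
Implicit Types (p q r : P) (phi psi : fprop P).

(** Since [fimp] is a negated conjunction, its conclusion only has to be forced densely below the
    conditions forcing the premise; [fex] treats witnesses likewise. *)
Lemma fimp_intro phi psi p :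
  (forall q, stronger q p -> phi q -> exists2 r, stronger r q & psi r) ->
  fimp phi psi p.
Proof.
by move=> h q qp [phiq npsi]; have [r rq /npsi] := h q qp phiq; exact.
Qed.

Lemma fimp_elim phi psi p q : fimp phi psi p -> stronger q p -> phi q ->
  exists2 r, stronger r q & psi r.
Proof.
move=> h qp phiq; apply: contrapT => npsi; apply: (h q qp).
by split=> // r rq psir; apply: npsi; exists r.
Qed.

Lemma fex_intro (X : Type) (phi : X -> fprop P) p :
  (forall q, stronger q p -> exists x, exists2 r, stronger r q & phi x r) ->
  fex phi p.
Proof. by move=> h q qp nphi; have [x [r rq]] := h q qp; exact: nphi. Qed.

Lemma fex_elim (X : Type) (phi : X -> fprop P) p q :
  fex phi p -> stronger q p -> exists x, exists2 r, stronger r q & phi x r.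
Proof.
move=> h qp; apply: contrapT => nphi; apply: (h q qp) => x r rq phir.
by apply: nphi; exists x, r.
Qed.

Lemma fmem_mono (X : Type) (x : X) (A : name P X) p q :
  fmem x A p -> stronger q p -> fmem x A q.
Proof. by move=> h qp r rq; apply: h; exact: stronger_trans qp. Qed.

Lemma fmem_check (X : Type) (x : X) (B : set X) p :
  fmem x (check_name P B) p <-> B x.
Proof.
split=> [/(_ p (stronger_refl p))[r _ [s]]//|Bx q qp].
by exists q; [exact: stronger_refl|exists (one P) => //; exact: stronger_one].
Qed.

Lemma fiff_check (A B : Prop) p :
  (A <-> B) -> fiff (@fcheck P A) (@fcheck P B) p.
Proof.
move=> AB; split; apply: fimp_intro => q _ /AB h.
all: by exists q => //; exact: stronger_refl.
Qed.

End Forcing.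

(** * The order of type omega_1 *)

Section Omega1.
Variables (W : Type) (lt : W -> W -> Prop).
Hypothesis hW : is_omega1 lt.
Implicit Types (a b c d : W).

Definition le a b := a = b \/ lt a b.

Lemma lt_irr a : ~ lt a a.
Proof. by case: hW => -[irr _] _ _ _; exact: irr. Qed.

Lemma lt_trans a b c : lt a b -> lt b c -> lt a c.
Proof. by case: hW => -[_ tr] _ _ _; exact: tr. Qed.

Lemma lt_min (B : set W) : B !=set0 -> exists2 m, B m & forall x, B x -> le m x.
Proof. by case: hW => _ [_ wo] _ _; exact: wo. Qed.

Lemma le_refl a : le a a. Proof. by left. Qed.

Lemma ltW a b : lt a b -> le a b. Proof. by right. Qed.

Lemma le_lt_trans a b c : le a b -> lt b c -> lt a c.
Proof. by move=> [->//|]; exact: lt_trans. Qed.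

Lemma lt_le_trans a b c : lt a b -> le b c -> lt a c.
Proof. by move=> ab [<-//|]; exact: lt_trans. Qed.

Lemma le_trans a b c : le a b -> le b c -> le a c.
Proof. by move=> [->//|ab] /(lt_le_trans ab); right. Qed.

Lemma le_or_lt a b : le a b \/ lt b a.
Proof.
case: hW => _ [tot _] _ _.
by case: (tot a b I I) => h; [left; right|left; left|right].
Qed.

Lemma le_nlt a b : le a b -> ~ lt b a.
Proof. by move=> ab /(le_lt_trans ab); exact: lt_irr. Qed.

Lemma le_anti a b : le a b -> le b a -> a = b.
Proof. by move=> [//|ab] /le_nlt. Qed.

Lemma le_max a b : exists c, le a c /\ le b c.
Proof.
case: (le_or_lt a b) => [ab|/ltW ba].
  by exists b; split=> //; exact: le_refl.
by exists a; split=> //; exact: le_refl.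
Qed.

Lemma lt_wf : well_founded lt.
Proof.
move=> a; apply: contrapT => na.
have [m nm minm] := @lt_min [set x | ~ Acc lt x] (ex_intro _ a na).
apply: nm; constructor => y ym; apply: contrapT => /minm.
by move=> /le_nlt; apply.
Qed.

Lemma countable_below a : countable [set b | lt b a].
Proof. by case: hW. Qed.

Lemma countable_le a : countable [set b | le b a].
Proof.
apply: (@countable_sub _ _ (\bigcup_(i in [set: bool])
  if i then [set a] else [set b | lt b a])).
  by move=> b [->|ba]; [exists true|exists false].
apply: bigcup_countable; first exact: countableP.
by move=> [] _; [exact: countable1|exact: countable_below].
Qed.

(** Otherwise [W] would be a union of countably many countable initial segments. *)
Lemma countable_bounded (S : set W) :
  countable S -> exists b, forall a, S a -> lt a b.
Proof.
move=> cS; apply: contrapT => nb.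
case: hW => _ _ + _; apply.
apply: (@countable_sub _ _ (\bigcup_(a in S) [set b | le b a])).
  move=> b _; apply: contrapT => nbS; apply: nb; exists b => a Sa.
  by case: (le_or_lt b a) => // ba; case: nbS; exists a.
by apply: bigcup_countable => // a _; exact: countable_le.
Qed.

Lemma inhabited_omega1 : exists a : W, True.
Proof.
by have [b _] := @countable_bounded set0 (countable0 _); exists b.
Qed.

Definition succ_of a s := lt a s /\ forall b, lt a b -> le s b.

Lemma succ_exists a : exists s, succ_of a s.
Proof.
have [b ab] := countable_bounded (countable1 a).
have [s as_ smin] := @lt_min [set s | lt a s] (ex_intro _ b (ab a erefl)).
by exists s; split.
Qed.

Lemma succ_of_le a s b : succ_of a s -> lt b s -> le b a.
Proof.
move=> [_ smin] bs; case: (le_or_lt b a) => // /smin /le_nlt.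
by move=> /(_ bs).
Qed.

Lemma succ_not_limit a s : succ_of a s -> ~ limit_ordinal lt s.
Proof.
move=> [as_ smin] [_ /(_ a as_)[c ac cs]].
exact: le_nlt (smin _ ac) cs.
Qed.

Lemma not_limit_cases a : ~ limit_ordinal lt a ->
  (forall b, ~ lt b a) \/ exists b, succ_of b a.
Proof.
move=> nlim; have [[b ba]|] := pselect (exists b, lt b a); last first.
  by move=> h; left => b ba; apply: h; exists b.
right; apply: contrapT => ns; apply: nlim; split; first by exists b.
move=> c ca; apply: contrapT => nc; apply: ns; exists c; split=> // d cd.
by case: (le_or_lt a d) => // da; case: nc; exists d.
Qed.

Lemma limit_above a b c : limit_ordinal lt a -> lt b a -> lt c a ->
  exists d, [/\ lt d a, lt b d & lt c d].
Proof.
move=> [_ lim] /lim[b' bb' b'a] /lim[c' cc' c'a].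
case: (le_or_lt b' c') => [b'c'|c'b'].
  by exists c'; split=> //; exact: lt_le_trans bb' b'c'.
by exists b'; split=> //; exact: lt_trans cc' c'b'.
Qed.

(** Closing off: iterate omega times a function dominating [G] on initial segments, and take the
    supremum. *)
Lemma club_closure_points (G : W -> set W) (a0 : W) :
  (forall b, countable (G b)) ->
  club lt [set l | [/\ limit_ordinal lt l, lt a0 l &
    forall b c, lt b l -> G b c -> lt c l]].
Proof.
move=> cG; split.
  move=> a lima h; split=> //.
    have [[b ba] _] := lima; have [c [[_ a0c _] _ ca]] := h b ba.
    exact: lt_trans a0c ca.
  move=> b c ba Gbc; have [d [[_ _ Gd] bd da]] := h b ba.
  exact: lt_trans (Gd _ _ bd Gbc) da.
move=> a.
have step b : exists b', lt b b' /\ forall d c, le d b -> G d c -> lt c b'.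
  have cU : countable (\bigcup_(i in [set: bool])
      if i then [set b] else \bigcup_(d in [set d | le d b]) G d).
    apply: bigcup_countable; first exact: countableP.
    move=> [] _; first exact: countable1.
    by apply: bigcup_countable => [|d _]; [exact: countable_le|exact: cG].
  have [b' b'P] := countable_bounded cU.
  exists b'; split; first by apply: b'P; exists true.
  by move=> d c db Gdc; apply: b'P; exists false => //; exists d.
have [f fP] := choice step.
have [a1 [aa1 a0a1]] : exists a1, le a a1 /\ le a0 a1 by exact: le_max.
pose s n := iter n f (f a1).
have ssn n : lt (s n) (s n.+1) by have [] := fP (s n).
have [u uP] := countable_bounded (countable_image s (countableP [set: nat])).
(* As the supremum of the iterates, [l] has every [b] below it bounded by some [s n], and then the
   members of [G b] lie below [s n.+1]. *)
have [l lP lmin] := @lt_min [set l | forall n, lt (s n) l]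
  (ex_intro _ u (fun n => uP _ (imageT s n))).
have bel b : lt b l -> exists n, le b (s n).
  move=> bl; apply: contrapT => nb.
  suff /lmin/le_nlt : [set l | forall n, lt (s n) l] b by apply.
  by move=> n; case: (le_or_lt b (s n)) => // bsn; case: nb; exists n.
have a1l : lt a1 l by apply: lt_trans (lP 0); have [] := fP a1.
exists l; last exact: le_lt_trans a1l.
split; last 1 first.
- move=> b c /bel[n bsn] Gbc; apply: lt_trans (lP n.+1).
  by have [_ /(_ _ _ bsn Gbc)] := fP (s n).
- split; first by exists a1.
  move=> b /bel[n bsn]; exists (s n.+1); last exact: lP.
  exact: le_lt_trans (ssn n).
- exact: le_lt_trans a1l.
Qed.

(** Row [a] consists of the iterated successors of a bound of all earlier rows, so rows are
    injective and pairwise disjoint. *)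
Lemma omega1_nat_inj : exists e : W -> nat -> W,
  forall b c m n, e b m = e c n -> b = c /\ m = n.
Proof.
have [w0 _] := inhabited_omega1.
have [] := @wf_recursive_choice W (nat -> W) lt (fun=> w0)
  (fun a P f => injective f /\ forall b m n, lt b a -> f m <> P b n) lt_wf.
- move=> a P Q f PQ [injf fP]; split=> // b m n ba.
  by rewrite -PQ//; exact: fP.
- move=> a P _.
  have cU : countable (\bigcup_(b in [set b | lt b a]) range (P b)).
    apply: bigcup_countable => [|b _]; first exact: countable_below.
    exact: countable_image (countableP _).
  have [u uP] := countable_bounded cU.
  have [f fP] := choice succ_exists.
  pose g n := iter n f u.
  have gP m n : m < n -> lt (g m) (g n).
    elim: n => // n IHn; rewrite ltnS leq_eqVlt => /orP[/eqP->|/IHn mn].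
      by have [] := fP (g n).
    by apply: lt_trans mn _; have [] := fP (g n).
  have gu n : le u (g n).
    by case: n => [|n]; [left|right; exact: (gP 0)].
  exists g; split=> [m n gmn|b m n ba gP'].
    case: (ltngtP m n) => // /gP; rewrite gmn => /lt_irr //.
  apply: (le_nlt (gu m)); rewrite gP'; apply: uP.
  by exists b => //; exists n.
- move=> e eP; exists e => b c m n ebc.
  have bc : b = c.
    case: (le_or_lt b c) => [[//|bc]|cb].
      by have [_ /(_ b n m bc)] := eP c; rewrite ebc.
    by have [_ /(_ c m n cb)] := eP b; rewrite ebc.
  by split=> //; move: ebc; rewrite bc; have [inj _] := eP c; exact: inj.
Qed.

(* Subsets of W x nat^2 are coded by an injection into W; the code of a subset
   of the predecessors of [l] lies below [l] when [l] is a closure point. *)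
Lemma diamond_guess : diamond lt ->
  exists D : W -> W -> nat * nat -> Prop,
  forall (A : W -> nat * nat -> Prop) (G : W -> set W) (a0 : W),
    (forall b, countable (G b)) ->
    exists l, [/\ limit_ordinal lt l, lt a0 l,
      forall b c, lt b l -> G b c -> lt c l &
      forall b q, lt b l -> (A b q <-> D l b q)].
Proof.
move=> [D [_ DP]]; have [e einj] := omega1_nat_inj.
exists (fun l b q => D l (e b (pickle q))) => A G a0 cG.
pose A' := [set x | exists b q, A b q /\ x = e b (pickle q)].
pose G' b := \bigcup_(i in [set: bool]) if i then G b else range (e b).
have cG' b : countable (G' b).
  apply: bigcup_countable; first exact: countableP.
  by move=> [] _; [exact: cG|exact: countable_image (countableP _)].
have [l [/= AD [liml a0l cl]]] := DP A' _ (club_closure_points a0 cG').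
exists l; split=> //.
  by move=> b c bl Gbc; apply: (cl b) => //; exists true.
move=> b q bl; rewrite -AD; split=> [Abq|].
  split; first by exists b, q.
  by apply: (cl b) => //; exists false => //; exists (pickle q).
by move=> [[b' [q' [Abq' /einj[-> /(pcan_inj pickleK)->]]]] _].
Qed.

(** * Affine levels *)

Local Open Scope ring_scope.

Variable F : countFieldType.
Local Notation X := (W -> F).

(** A function on the predecessors of [a] is coded by a total function that is zero elsewhere, so
    that all levels share one type. *)
Definition restr a (x : X) : X := fun w => if pselect (lt w a) then x w else 0.

Lemma restr_in a x w : lt w a -> restr a x w = x w.
Proof. by rewrite /restr; case: pselect. Qed.

Lemma restr_out a x w : ~ lt w a -> restr a x w = 0.
Proof. by rewrite /restr; case: pselect. Qed.

Lemma restr_eq a x y : (forall w, lt w a -> x w = y w) -> restr a x = restr a y.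
Proof.
move=> xy; apply/funext => w; rewrite /restr.
by case: pselect => // wa; exact: xy.
Qed.

Lemma restr_restr a b x : le a b -> restr a (restr b x) = restr a x.
Proof.
move=> ab; apply: restr_eq => w wa; rewrite restr_in//.
exact: lt_le_trans ab.
Qed.

Lemma restr_eqP a x y w : restr a x = y -> lt w a -> x w = y w.
Proof. by move=> <- wa; rewrite restr_in. Qed.

Lemma restr_le a b x : le a b -> restr a x = x -> restr b x = x.
Proof.
move=> ab xE; apply/funext => w; rewrite /restr; case: pselect => // wb.
by rewrite -xE restr_out// => wa; apply: wb; exact: lt_le_trans ab.
Qed.

(** For nonempty sets, these are the translates of linear subspaces. With [t = 1] and [x = y] the
    formula is the reflection of [z] in [x]. *)
Definition affine (A : set X) := forall x y z (t : F), A x -> A y -> A z ->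
  A (fun w => x w + t * (y w - z w)).

(* The affine combination of the points [x 0, x 1, ...] whose barycentric
   coordinate at [x j.+1] is the j-th coefficient of [k]. *)
Definition acomb (x : nat -> X) (k : {poly F}) : X :=
  fun w => x 0%N w + \sum_(j < size k) k`_j * (x j.+1 w - x 0%N w).

Lemma acomb_wide x (k : {poly F}) N w : (size k <= N)%N ->
  acomb x k w = x 0%N w + \sum_(j < N) k`_j * (x j.+1 w - x 0%N w).
Proof.
move=> kN; congr (_ + _).
rewrite (big_ord_widen N (fun j => k`_j * (x j.+1 w - x 0%N w)))//.
rewrite [LHS]big_mkcond /=; apply: eq_bigr => j _.
by case: ltnP => // kj; rewrite nth_default// mul0r.
Qed.

(** The base point cancels in the difference, so coordinates combine linearly and the range of
    [acomb x] is affine. Polynomials act as the countable type of finitely supported coefficient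
    sequences. *)
Lemma acomb_affine x (k l m : {poly F}) t :
  (fun w => acomb x k w + t * (acomb x l w - acomb x m w)) =
  acomb x (k + t *: (l - m)).
Proof.
apply/funext => w; set h := k + _.
pose N := maxn (maxn (size k) (size l)) (maxn (size m) (size h)).
rewrite !(@acomb_wide _ _ N) ?leq_max ?leqnn ?orbT//.
set a := x 0%N w; rewrite -addrA opprD addrACA subrr add0r -sumrB big_distrr /=.
rewrite -big_split /=; congr (_ + _); apply: eq_bigr => j _.
by rewrite coefD coefZ coefB; ring.
Qed.

Lemma acomb0 x : acomb x 0 = x 0%N.
Proof. by apply/funext => w; rewrite /acomb size_poly0 big_ord0 addr0. Qed.

Lemma acombXn x j : acomb x 'X^j = x j.+1.
Proof.
apply/funext => w; rewrite /acomb size_polyXn big_ord_recr big1 /=.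
  by rewrite coefXn eqxx mul1r add0r addrC subrK.
by move=> i _; rewrite coefXn ltn_eqF// mul0r.
Qed.

Lemma acomb_ext x y (k : {poly F}) : (forall j, (j <= size k)%N -> x j = y j) ->
  acomb x k = acomb y k.
Proof.
move=> xy; apply/funext => w; rewrite /acomb !xy//; congr (_ + _).
by apply: eq_bigr => j _; rewrite xy.
Qed.

Lemma restr_acomb a x k :
  restr a (acomb x k) = acomb (fun j => restr a (x j)) k.
Proof.
apply/funext => w; have [wa|wa] := pselect (lt w a).
  rewrite restr_in// /acomb restr_in//; congr (_ + _).
  by apply: eq_bigr => j _; rewrite restr_in.
rewrite restr_out// /acomb restr_out// add0r big1// => j _.
by rewrite restr_out// subrr mulr0.
Qed.

Lemma acomb_mem (A : set X) x (k : {poly F}) :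
  affine A -> (forall j, (j <= size k)%N -> A (x j)) -> A (acomb x k).
Proof.
move=> affA Ax; rewrite /acomb.
suff H n : (n <= size k)%N ->
  A (fun w => x 0%N w + \sum_(j < n) k`_j * (x j.+1 w - x 0%N w)) by exact: H.
elim: n => [_|n IHn nk].
  rewrite (_ : (fun w => _) = x 0%N); first exact: Ax.
  by apply/funext => w; rewrite big_ord0 addr0.
have := affA _ _ _ k`_n (IHn (ltnW nk)) (Ax n.+1 nk) (Ax 0%N isT).
by congr A; apply/funext => w; rewrite big_ord_recr /= addrA.
Qed.

(** The candidates for level [a] over coherent levels [P]: at a limit the cofinal branches, at a
    successor all one-point extensions of nodes of the level before. *)
Definition branches a (P : W -> set X) : set X :=
  [set x | restr a x = x /\ forall b, lt b a -> P b (restr b x)].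

Definition dense_below l (P : W -> set X) (E : W -> X -> X -> Prop) :=
  forall d u v, lt d l -> P d u -> P d v -> exists d' u' v',
    [/\ lt d' l, le d d', P d' u' & P d' v'] /\
    [/\ restr d u' = u, restr d v' = v & E d' u' v'].

(** * Mutually generic branches at a limit level *)

Section LimitLevel.
Variables (l : W) (P : W -> set X) (E : W -> X -> X -> Prop).
Hypotheses (liml : limit_ordinal lt l)
  (P_branch : forall b, lt b l -> P b `<=` branches b P)
  (P_affine : forall b, lt b l -> affine (P b))
  (P_countable : forall b, lt b l -> countable (P b))
  (P_nonempty : forall b, lt b l -> P b !=set0)
  (P_ext : forall b d y, lt b d -> lt d l -> P b y ->
    exists2 x, P d x & restr b x = y)
  (E_dense : dense_below l P E).

Lemma P_supp b y : lt b l -> P b y -> restr b y = y.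
Proof. by move=> bl /(P_branch bl)[]. Qed.

Lemma P_extend b d y : le b d -> lt d l -> P b y ->
  exists2 x, P d x & restr b x = y.
Proof.
move=> [->|bd] dl Py; last exact: P_ext.
by exists y => //; exact: P_supp.
Qed.

Lemma P_restr b d y : le b d -> lt d l -> P d y -> P b (restr b y).
Proof.
move=> [->|bd] dl Py; first by rewrite P_supp.
by have [_] := P_branch dl Py; apply.
Qed.

Section Conditions.
Variable start : nat -> W * X.
Hypothesis startP : forall j, lt (start j).1 l /\ P (start j).1 (start j).2.

(* A condition [(n, d, x)] approximates the first [n] of the generic branches
   through the prescribed nodes [start] by nodes [x j] of level [d]. *)
Definition condition (p : nat * W * (nat -> X)) :=
  lt p.1.2 l /\ forall j, (j < p.1.1)%N ->
    [/\ P p.1.2 (p.2 j), le (start j).1 p.1.2 &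
      restr (start j).1 (p.2 j) = (start j).2].

Definition extends (p q : nat * W * (nat -> X)) :=
  [/\ (p.1.1 <= q.1.1)%N, le p.1.2 q.1.2 &
    forall j, (j < p.1.1)%N -> restr p.1.2 (q.2 j) = p.2 j].

Lemma extends_refl p : condition p -> extends p p.
Proof.
move=> [dl cp]; split=> [//||j /cp[Px _ _]]; first exact: le_refl.
exact: P_supp.
Qed.

Lemma extends_trans p q r : extends p q -> extends q r -> extends p r.
Proof.
move=> [npq dpq pq] [nqr dqr qr]; split.
- exact: leq_trans nqr.
- exact: le_trans dqr.
- move=> j jp; rewrite -pq// -qr ?restr_restr//.
  exact: leq_trans npq.
Qed.

Lemma condition_restr n d x d' x' :
  le d d' -> lt d' l -> condition (n, d, x) ->
  (forall j, (j < n)%N -> P d' (x' j) /\ restr d (x' j) = x j) ->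
  condition (n, d', x').
Proof.
move=> dd' d'l [_ cx] x'P; split=> //= j jn.
have [Px' x'x] := x'P j jn; have /= [_ sd xs] := cx j jn.
split=> //; first exact: le_trans dd'.
by rewrite -xs -x'x restr_restr.
Qed.

Lemma condition_lift n d x d' : condition (n, d, x) -> le d d' -> lt d' l ->
  exists x', condition (n, d', x') /\ extends (n, d, x) (n, d', x').
Proof.
move=> cp dd' d'l; have [dl cx] := cp.
have ex_lift j : exists y, (j < n)%N -> P d' y /\ restr d y = x j.
  have [jn|] := boolP (j < n)%N; last by exists (x j).
  have [Px _ _] := cx j jn.
  by have [y Py yx] := P_extend dd' d'l Px; exists y.
have [x' x'P] := choice ex_lift.
exists x'; split; first exact: condition_restr x'P.
by split=> // j /x'P[].
Qed.

(** The new branch, number [n], is put through [start n]; in the end every prescribed node lies on a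
    branch. *)
Lemma condition_add p b : condition p -> lt b l ->
  exists q, [/\ condition q, extends p q, q.1.1 = p.1.1.+1 & lt b q.1.2].
Proof.
case: p => [[n d] x] cp bl; have [dl cx] := cp; have [sl Ps] := startP n.
have [d1 [d1l dd1 bd1]] := limit_above liml dl bl.
have [d' [d'l d1d' sd']] := limit_above liml d1l sl.
have bd' : lt b d' by exact: lt_trans bd1 d1d'.
have dd' : le d d' by right; exact: lt_trans dd1 d1d'.
have [x1 [[_ c1] [_ _ e1]]] := condition_lift cp dd' d'l.
have [y Py ys] := P_extend (ltW sd') d'l Ps.
exists (n.+1, d', fun j => if (j < n)%N then x1 j else y); split=> //.
- split=> //= j; rewrite ltnS; case: ltnP => [jn _|nj jn]; first exact: c1.
  have -> : j = n by apply/eqP; rewrite eqn_leq jn.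
  by split=> //; exact: ltW.
- by split=> //= j jn; rewrite jn; exact: e1.
Qed.

Lemma condition_reach p m b : condition p -> lt b l ->
  exists q, [/\ condition q, extends p q, (m < q.1.1)%N & lt b q.1.2].
Proof.
move=> cp bl; elim: m => [|m [q [cq pq mq bq]]].
  have [q [cq pq nq bq]] := condition_add cp bl.
  by exists q; split=> //; rewrite nq.
have [r [cr qr nr br]] := condition_add cq bl.
by exists r; split=> //; [exact: extends_trans qr|rewrite nr].
Qed.

Lemma acomb_condition p (k : {poly F}) : condition p -> (size k < p.1.1)%N ->
  P p.1.2 (acomb p.2 k).
Proof.
move=> [dl cp] kn; apply: acomb_mem; first exact: P_affine.
by move=> j jk; have [] := cp j (leq_ltn_trans jk kn).
Qed.

(* Two distinct affine combinations of the branches can be steered to any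
   prescribed extensions [u], [v]: translate all points by [al] and then the
   point [i.+1], at which the two coordinates differ, by [be]. *)
Lemma condition_steer n d x d' (k h : {poly F}) u v : condition (n, d, x) ->
  (size k < n)%N -> (size h < n)%N -> k <> h -> le d d' -> lt d' l ->
  P d' u -> P d' v -> restr d u = acomb x k -> restr d v = acomb x h ->
  exists x', [/\ condition (n, d', x'), extends (n, d, x) (n, d', x'),
    acomb x' k = u & acomb x' h = v].
Proof.
move=> cp kn hn kh dd' d'l Pu Pv uE vE.
have [i ikh] : exists i, k`_i != h`_i.
  apply: contrapT => nkh; apply: kh; apply/polyP => i; apply/eqP.
  by apply: contrapT => /negP ikh; apply: nkh; exists i.
have [x1 [cx1 /= [_ _ /= ex1]]] := condition_lift cp dd' d'l.
pose du w := u w - acomb x1 k w; pose dv w := v w - acomb x1 h w.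
(* [al] and [be] solve the linear system [al + k_i be = du], [al + h_i be = dv], whose determinant
   is [h_i - k_i]. *)
pose t := (h`_i - k`_i)^-1.
pose be w := t * (dv w - du w); pose al w := du w - k`_i * be w.
pose x' j : X := fun w => x1 j w + al w + (if j == i.+1 then be w else 0).
have nz : h`_i - k`_i != 0 by rewrite subr_eq0 eq_sym.
have acE (q : {poly F}) w : acomb x' q w = acomb x1 q w + al w + q`_i * be w.
  rewrite (@acomb_wide _ _ (maxn (size q) i.+1)) ?leq_maxl//.
  rewrite (@acomb_wide x1 _ (maxn (size q) i.+1)) ?leq_maxl//.
  have iN : (i < maxn (size q) i.+1)%N by rewrite leq_maxr.
  rewrite (bigD1 (Ordinal iN)) //= [in RHS](bigD1 (Ordinal iN)) //=.
  rewrite (eq_bigr (fun j : 'I_(maxn (size q) i.+1) =>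
    q`_j * (x1 j.+1 w - x1 0%N w))).
    by rewrite /x' eqxx /=; ring.
  move=> j ji; rewrite /x' eqSS /= ifN; first by ring.
  by apply: contra ji => /eqP ji; apply/eqP/val_inj.
have Px1 j : (j < n)%N -> P d' (x1 j).
  by have [_ /(_ j)] := cx1 => + /[dup] jn => /(_ jn)[].
have Pk : P d' (acomb x1 k) by exact: (acomb_condition cx1).
have Ph : P d' (acomb x1 h) by exact: (acomb_condition cx1).
(* Below [d] the errors [du] and [dv] vanish, both points restricting to the same combination of
   [x]; hence the corrected points still extend [x]. *)
have e0 (k' : {poly F}) (u' : X) w : (size k' < n)%N ->
    restr d u' = acomb x k' -> lt w d -> u' w - acomb x1 k' w = 0.
  move=> k'n u'E wd; apply/eqP; rewrite subr_eq0; apply/eqP.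
  rewrite (restr_eqP u'E wd).
  suff /restr_eqP -> : restr d (acomb x1 k') = acomb x k' by [].
  rewrite restr_acomb; apply: acomb_ext => j jk; apply: ex1.
  exact: leq_ltn_trans jk k'n.
have x'P j : (j < n)%N -> P d' (x' j) /\ restr d (x' j) = x j.
  move=> jn; split.
    have aff := P_affine d'l.
    (* Expanded, the correction of [x1 j] is a multiple of [u - acomb x1 k] plus a multiple of
       [v - acomb x1 h], so affineness of level [d'] applies twice. *)
    pose s : F := if j == i.+1 then 1 else 0.
    have h1 := aff _ _ _ (1 + k`_i * t - s * t) (Px1 j jn) Pu Pk.
    have h2 := aff _ _ _ (s * t - k`_i * t) h1 Pv Ph.
    move: h2; congr (P _ _); apply/funext => w.
    by rewrite /x' /s /al /be /du /dv; case: (j == i.+1); ring.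
  rewrite -ex1//; apply: restr_eq => w wd.
  have al0 : du w = 0 by exact: e0.
  have be0 : dv w = 0 by exact: e0.
  by rewrite /x' /al /be al0 be0; case: ifP => _; ring.
exists x'; split.
- exact: condition_restr x'P.
- by split=> //= j /x'P[].
- by apply/funext => w; rewrite acE /al /du; ring.
- apply/funext => w; rewrite acE /al.
  have beE : (h`_i - k`_i) * be w = dv w - du w.
    by rewrite /be /t mulrA mulfV// mul1r.
  transitivity (acomb x1 h w + du w + (h`_i - k`_i) * be w); first by ring.
  by rewrite beE /dv; ring.
Qed.

(** The branches [c] are the limits of a generic sequence [s] of conditions. The sequence is kept
    because its members witness that any two combinations with distinct coefficients pass through
    [E]. *)
Lemma generic_branches :
  exists c : nat -> X, exists s : nat -> nat * W * (nat -> X),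
  [/\ forall m, condition (s m),
      forall N b, lt b l -> exists m, (N < (s m).1.1)%N /\ lt b (s m).1.2,
      forall m j, (j < (s m).1.1)%N -> restr (s m).1.2 (c j) = (s m).2 j,
      forall j, restr l (c j) = c j &
      forall k h : {poly F}, k <> h -> exists m,
        [/\ (size k < (s m).1.1)%N, (size h < (s m).1.1)%N &
          E (s m).1.2 (acomb (s m).2 k) (acomb (s m).2 h)]].
Proof.
have [beta betaE] : exists f : nat -> W, range f = [set b | lt b l].
  by apply: countable_range; [exact: countable_below|case: liml].
have betal i : lt (beta i) l.
  by have : range beta (beta i) by []; rewrite betaE.
have [b0 b0l] := liml.1.
(* [inl i] asks for branch number [i] and for height above [beta i]; [inr (k, h)] asks that the
   combinations given by [k] and [h] meet [E]. *)
pose task (i : nat + {poly F} * {poly F}) (p : nat * W * (nat -> X)) :=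
  match i with
  | inl i => (i < p.1.1)%N /\ lt (beta i) p.1.2
  | inr (k, h) => k <> h -> [/\ (size k < p.1.1)%N, (size h < p.1.1)%N &
      E p.1.2 (acomb p.2 k) (acomb p.2 h)]
  end.
have task_dense i p : condition p ->
    exists q, [/\ condition q, extends p q & task i q].
  move=> cp; case: i => [i|[k h]].
    have [q [cq pq iq bq]] := condition_reach i cp (betal i).
    by exists q.
  have [kh|kh] := pselect (k = h).
    by exists p; split=> //; exact: extends_refl.
  have [[[n d] x] [cq pq /= kn dq]] :=
    condition_reach (maxn (size k) (size h)) cp b0l.
  move: kn; rewrite gtn_max => /andP[kn hn].
  have dl : lt d l by case: cq.
  (* Density extends the two combinations to a pair in [E]; steering then makes the branches realize
     this pair. *)
  have [d' [u [v [[d'l dd' Pu Pv] [uE vE Euv]]]]] := E_dense dl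
    (@acomb_condition _ k cq kn) (@acomb_condition _ h cq hn).
  have [x' [cx' ex' kE hE]] :=
    condition_steer cq kn hn kh dd' d'l Pu Pv uE vE.
  exists (n, d', x'); split=> //; first exact: extends_trans ex'.
  by move=> _ /=; rewrite kE hE.
have c0 : condition (0%N, b0, fun=> fun=> 0) by split.
have [s [cs es ts]] :=
  generic_sequence extends_refl extends_trans task_dense c0.
have reach N b : lt b l -> exists m, (N < (s m).1.1)%N /\ lt b (s m).1.2.
  move=> bl; have [i _ ib] : range beta b by rewrite betaE.
  have [m1 [_ b1]] := ts (inl i); have [m2 [n2 _]] := ts (inl N).
  exists (maxn m1 m2).
  have [_ d1 _] := es _ _ (leq_maxl m1 m2).
  have [n3 _ _] := es _ _ (leq_maxr m1 m2).
  split; first exact: leq_trans n3.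
  by rewrite -ib; exact: lt_le_trans d1.
have coh j w m m' : (j < (s m).1.1)%N -> lt w (s m).1.2 -> (m <= m')%N ->
    (s m').2 j w = (s m).2 j w.
  move=> jm wm mm'; have [_ _ /(_ j jm) h] := es _ _ mm'.
  exact: (restr_eqP h).
(* All conditions deciding branch [j] at [w] agree there; off the predecessors of [l] the value is
   0, as the coding of level [l] demands. *)
have ex_val (jw : nat * W) : exists v : F,
    (forall m, (jw.1 < (s m).1.1)%N -> lt jw.2 (s m).1.2 ->
       v = (s m).2 jw.1 jw.2) /\ (~ lt jw.2 l -> v = 0).
  case: jw => j w /=; have [wl|wl] := pselect (lt w l); last first.
    exists 0; split=> // m _ wm; case: wl; apply: lt_trans wm _.
    by have [] := cs m.
  have [m [jm wm]] := reach j w wl.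
  exists ((s m).2 j w); split=> // m' jm' wm'.
  by case: (leqP m m') => [mm'|/ltnW m'm]; [rewrite (coh _ _ m)|apply: coh].
have [v vP] := choice ex_val.
exists (fun j w => v (j, w)), s; split=> //.
- move=> m j jm; apply/funext => w.
  have [wm|wm] := pselect (lt w (s m).1.2).
    by rewrite restr_in//; have [/(_ m jm wm)] := vP (j, w).
  have [dl /(_ j jm)[Px _ _]] := cs m.
  by rewrite restr_out// -(P_supp dl Px) restr_out.
- move=> j; apply/funext => w.
  have [wl|wl] := pselect (lt w l); first by rewrite restr_in.
  by rewrite restr_out//; have [_ ->] := vP (j, w).
- move=> k h kh; have [m /(_ kh)] := ts (inr (k, h)).
  by exists m.
Qed.

End Conditions.

(** The level consists of the affine combinations of the generic branches. Distinct points have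
    distinct coefficients, so genericity sends them through [E]. Every earlier node occurs in the
    enumeration [start] and so has an extension. *)
Lemma limit_level : exists S : set X,
  [/\ S `<=` branches l P, affine S & countable S] /\
  [/\ S !=set0,
      forall b y, lt b l -> P b y -> exists2 x, S x & restr b x = y &
      forall u v, S u -> S v -> u <> v ->
        exists2 b, lt b l & E b (restr b u) (restr b v)].
Proof.
pose nodes : set (W * X) :=
  \bigcup_(b in [set b | lt b l]) [set (b, y) | y in P b].
have [start startE] : exists f : nat -> W * X, range f = nodes.
  apply: countable_range.
    apply: bigcup_countable => [|b bl]; first exact: countable_below.
    exact: countable_image (P_countable bl).
  have [b bl] := liml.1; have [y Py] := P_nonempty bl.
  by exists (b, y), b => //; exists y.
have startP j : lt (start j).1 l /\ P (start j).1 (start j).2.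
  have : range start (start j) by [].
  by rewrite startE => -[b bl [y Py <-]].
have [c [s [cs reach cE csupp sealed]]] := generic_branches startP.
have acE (k : {poly F}) m : (size k < (s m).1.1)%N ->
    restr (s m).1.2 (acomb c k) = acomb (s m).2 k.
  move=> km; rewrite restr_acomb; apply: acomb_ext => j jk.
  by apply: cE; exact: leq_ltn_trans km.
exists (range (acomb c)); split; split.
- move=> _ [k _ <-]; split.
    by rewrite restr_acomb; apply: acomb_ext => j _.
  move=> b bl; have [m [km bm]] := reach (size k) b bl.
  rewrite -(restr_restr _ (ltW bm)) acE//.
  have [dl _] := cs m.
  by apply: P_restr (ltW bm) dl _; exact: (acomb_condition (cs m)).
- move=> _ _ _ t [k _ <-] [h _ <-] [g _ <-].
  by rewrite acomb_affine; exists (k + t *: (h - g)).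
- exact: countable_image (countableP _).
- by exists (acomb c 0), 0.
- move=> b y bl Py.
  have [j _ jE] : range start (b, y).
    by rewrite startE; exists b => //; exists y.
  exists (c j).
    (* Each branch is itself a combination: the zero polynomial gives the base point, monomials give
       the others. *)
    by case: j {jE} => [|j]; [exists 0 => //; exact: acomb0
                             |exists 'X^j => //; exact: acombXn].
  have [m [jm bm]] := reach j b bl.
  have [_ /(_ j jm)[_ _]] := cs m.
  by rewrite -cE// jE /= restr_restr//; exact: ltW.
- move=> _ _ [k _ <-] [h _ <-] kh.
  have [|m [km hm Em]] := sealed k h; first by move=> kh'; rewrite kh' in kh.
  exists (s m).1.2; first by have [] := cs m.
  by rewrite !acE.
Qed.

End LimitLevel.

(** * Recursive construction of the levels from diamond *)

Definition dense (L : W -> set X) (E : W -> X -> X -> Prop) :=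
  forall d u v, L d u -> L d v -> exists d' u' v',
    [/\ le d d', L d' u' & L d' v'] /\
    [/\ restr d u' = u, restr d v' = v & E d' u' v'].

(** The interface between the construction and the tree arguments; diamond enters only through
    [level_seal]. *)
Record sealed_levels (L : W -> set X) : Prop := {
  level_branch : forall a, L a `<=` branches a L;
  level_affine : forall a, affine (L a);
  level_count : forall a, countable (L a);
  level_nonempty : forall a, L a !=set0;
  level_ext : forall a b y, lt b a -> L b y -> exists2 x, L a x & restr b x = y;
  level_succ : forall a, ~ limit_ordinal lt a -> branches a L `<=` L a;
  level_seal : forall E a0, dense L E ->
    exists l, [/\ limit_ordinal lt l, lt a0 l &
      forall u v, L l u -> L l v -> u <> v ->
        exists2 b, lt b l & E b (restr b u) (restr b v)]
}.

Lemma branches_affine a P :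
  (forall b, lt b a -> affine (P b)) -> affine (branches a P).
Proof.
move=> affP x y z t [xa Px] [ya Py] [za Pz]; split.
  apply/funext => w; have [wa|wa] := pselect (lt w a).
    by rewrite restr_in.
  by rewrite -xa -ya -za !restr_out// subrr mulr0 addr0.
move=> b ba; have := affP b ba _ _ _ t (Px b ba) (Py b ba) (Pz b ba).
congr (P b _); apply/funext => w.
have [wb|wb] := pselect (lt w b); first by rewrite !restr_in.
by rewrite !restr_out// subrr mulr0 addr0.
Qed.

(** A function on the predecessors of [s] is determined by its restriction to [a] and its value at
    [a], and [F] is countable. *)
Lemma branches_succ_countable a s P : succ_of a s ->
  countable (P a) -> countable (branches s P).
Proof.
move=> [as_ smin] cP.
apply: (@countable_sub _ _ ((fun yt : X * F =>
    fun w => if pselect (lt w a) then yt.1 w else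
             if pselect (lt w s) then yt.2 else 0) @`
  (P a `*` [set: F]))); last first.
  by apply: countable_image; apply: countableX => //; exact: countableP.
move=> x [xs Px]; exists (restr a x, x a); first by split=> //=; exact: Px.
apply/funext => w /=; case: pselect => wa; first by rewrite restr_in.
case: pselect => ws /=; last by rewrite -xs restr_out.
congr x; apply: le_anti; first by case: (le_or_lt a w).
exact: succ_of_le ws.
Qed.

(** A limit level seals the guessed relation if that is dense below it; the other levels take all
    branches. A given dense [E] is sealed at a limit where the guess is correct and which is closed
    under the levels of density witnesses. *)
Lemma sealed_levels_exist : diamond lt -> exists L, sealed_levels L.
Proof.
move=> hD; have [D DP] := diamond_guess hD.
(* The enumeration depends on the set alone, so an index denotes the same node at every stage of the
   recursion. *)
have ex_enum (A : set X) : exists f : nat -> X,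
    countable A -> A !=set0 -> range f = A.
  have [[cA A0]|h] := pselect (countable A /\ A !=set0).
    by have [f fA] := countable_range cA A0; exists f.
  by exists (fun=> fun=> 0) => cA A0; case: h.
have [enum enumP] := choice ex_enum.
pose guess l (P : W -> set X) d u v := exists m n,
  [/\ u = enum (P d) m, v = enum (P d) n & D l d (m, n)].
pose good a (P : W -> set X) (S : set X) :=
  [/\ S `<=` branches a P, affine S, countable S & S !=set0] /\
  [/\ forall b y, lt b a -> P b y -> exists2 x, S x & restr b x = y,
      ~ limit_ordinal lt a -> branches a P `<=` S &
      limit_ordinal lt a -> dense_below a P (guess a P) ->
        forall u v, S u -> S v -> u <> v ->
          exists2 b, lt b a & guess a P b (restr b u) (restr b v)].
have good_local a P Q S : (forall b, lt b a -> P b = Q b) ->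
    good a P S -> good a Q S.
  move=> PQ; have QP b : lt b a -> Q b = P b by move=> /PQ.
  have brE : branches a P = branches a Q.
    apply/seteqP; split=> x [xa Px]; split=> // b ba.
      by rewrite -PQ//; exact: Px.
    by rewrite PQ//; exact: Px.
  have gE d u v : lt d a -> guess a P d u v <-> guess a Q d u v.
    by move=> da; rewrite /guess PQ.
  rewrite /good brE => -[? [Pext Psucc Pseal]]; split=> //; split=> //.
    by move=> b y ba; rewrite QP//; exact: Pext.
  move=> lima dn u v Su Sv uv.
  have [|b ba /gE] := Pseal lima _ u v Su Sv uv; last by exists b; auto.
  move=> d u' v' da; rewrite PQ// => Qu Qv.
  have [d1 [u1 [v1 [[d1a dd1 Qu1 Qv1] [u1E v1E /gE g1]]]]] :=
    dn d u' v' da Qu Qv.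
  exists d1, u1, v1; split; first by rewrite PQ.
  by split=> //; exact: g1.
have good_step a P : (forall b, lt b a -> good b P (P b)) ->
    exists S, good a P S.
  move=> IH.
  have [lima|nlim] := pselect (limit_ordinal lt a).
    (* With the density of the guess as a premise, [E] is dense in every case, so the limit
       construction applies even when the guess is not dense. *)
    pose E d u v := dense_below a P (guess a P) -> guess a P d u v.
    have [||||||S [[S1 S2 S3] [S4 S5 S6]]] := @limit_level a P E lima.
    - by move=> b /IH[[]].
    - by move=> b /IH[[]].
    - by move=> b /IH[[]].
    - by move=> b /IH[[]].
    - move=> b d y bd da Py; have [_ [h _ _]] := IH d da.
      exact: h.
    - have [dn|ndn] := pselect (dense_below a P (guess a P)).
        move=> d u v da Pu Pv.
        have [d1 [u1 [v1 [h1 [h2 h3 h4]]]]] := dn d u v da Pu Pv.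
        by exists d1, u1, v1; split=> //; split=> // _.
      move=> d u v da Pu Pv; exists d, u, v.
      have [[h _ _ _] _] := IH d da.
      have [uE _] := h u Pu; have [vE _] := h v Pv.
      by split; split=> //; exact: le_refl.
    - exists S; split=> //; split=> [//|/(_ lima)//|_ dn u v Su Sv uv].
      by have [b ba Eb] := S6 u v Su Sv uv; exists b => //; exact: Eb.
  exists (branches a P).
  have aff : affine (branches a P).
    by apply: branches_affine => b /IH[[]].
  have [a0|[a' a'a]] := not_limit_cases nlim.
    have supp0 x : restr a x = fun=> 0.
      by apply/funext => w; rewrite restr_out//; exact: a0.
    split; split=> //.
    - apply: (@countable_sub _ _ [set fun=> 0]); last exact: countable1.
      by move=> x [<- _]; rewrite supp0.
    - by exists (fun=> 0); split; [exact: supp0|move=> b /a0].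
    - by move=> b y /a0.
    - by move=> _ x.
  have a'lt : lt a' a by case: a'a.
  have [[br' _ c' [z Pz]] [ext' _ _]] := IH a' a'lt.
  have lift x : P a' x -> branches a P x.
    move=> Px; have [x' Px'] := br' x Px.
    split; first by apply: restr_le x'; exact: ltW.
    move=> b ba; case: (succ_of_le a'a ba) => [->|]; last exact: Px'.
    by rewrite x'.
  split; split=> //.
  - exact: branches_succ_countable a'a c'.
  - by exists z; exact: lift.
  - move=> b y ba Py; case: (succ_of_le a'a ba) => [ba'|ba'].
      exists y; first by apply: lift; rewrite -ba'.
      by rewrite ba'; rewrite ba' in Py; have [] := br' y Py.
    by have [x Px xy] := ext' b y ba' Py; exists x => //; exact: lift.
  - by move=> _ x.
have [L LP] := wf_recursive_choice set0 lt_wf good_local good_step.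
exists L; split; try by move=> a; have [[]] := LP a.
- by move=> a; have [_ []] := LP a.
- by move=> a; have [_ []] := LP a.
move=> E a0 dnE.
(* [wit] picks the level of a density witness for each pair. Levels being countable, so is each
   [G d], and a correctly guessing [l] can be taken closed under [G]. *)
have ex_wit (q : W * X * X) : exists d', L q.1.1 q.1.2 -> L q.1.1 q.2 ->
    exists u' v', [/\ le q.1.1 d', L d' u' & L d' v'] /\
      [/\ restr q.1.1 u' = q.1.2, restr q.1.1 v' = q.2 & E d' u' v'].
  case: q => [[d u] v] /=.
  have [[Lu Lv]|h] := pselect (L d u /\ L d v); last first.
    by exists d => Lu Lv; case: h.
  have [d' [u' [v' h]]] := dnE d u v Lu Lv.
  by exists d' => _ _; exists u', v'.
have [wit witP] := choice ex_wit.
pose G d := [set wit (d, uv.1, uv.2) | uv in L d `*` L d].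
have cG d : countable (G d).
  apply: countable_image; apply: countableX.
    by have [[]] := LP d.
  by have [[]] := LP d.
have [l [liml a0l Gl Al]] := DP
  (fun d q => E d (enum (L d) q.1) (enum (L d) q.2)) G a0 cG.
exists l; split=> // u v Lu Lv uv.
have gE d u' v' : lt d l -> L d u' -> L d v' ->
    guess l L d u' v' <-> E d u' v'.
  move=> dl Lu' Lv'; split=> [[m [n [-> -> /(Al _ _ dl)]]]//|Euv].
  have enE : range (enum (L d)) = L d.
    by have [[_ _ cL L0] _] := LP d; exact: enumP.
  move: Lu' Lv'; rewrite -enE => -[m _ mE] [n _ nE].
  exists m, n; split=> //; apply/Al => //=.
  by rewrite mE nE.
have [[brl _ _ _] [_ _ seal]] := LP l.
have [|b bl gb] := seal liml _ u v Lu Lv uv.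
  move=> d u' v' dl Lu' Lv'.
  have [u1 [v1 [[h1 h2 h3] [h4 h5 h6]]]] := witP (d, u', v') Lu' Lv'.
  have wl : lt (wit (d, u', v')) l by apply: Gl dl _; exists (u', v').
  exists (wit (d, u', v')), u1, v1; split; split=> //.
  exact/gE.
exists b => //; apply/gE => //.
  by have [_] := brl u Lu; apply.
by have [_] := brl v Lv; apply.
Qed.

(** * The tree of affine levels *)

Section AffineTree.
Variable L : W -> set X.
Hypothesis HL : sealed_levels L.

Definition anode := {p : W * X | L p.1 p.2}.
Definition lev (x : anode) : W := (sval x).1.
Definition seqn (x : anode) : X := (sval x).2.
Definition alt (x y : anode) :=
  lt (lev x) (lev y) /\ restr (lev x) (seqn y) = seqn x.

Lemma anodeP (x : anode) : L (lev x) (seqn x).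
Proof. exact: (svalP x). Qed.

Lemma anode_eq (x y : anode) : lev x = lev y -> seqn x = seqn y -> x = y.
Proof.
case: x y => [[a x] /= Lx] [[b y] /= Ly]; rewrite /lev /seqn /= => ab xy.
by case: _ / ab in Ly *; case: _ / xy in Ly *; rewrite (Prop_irrelevance Lx Ly).
Qed.

Lemma seqn_supp x : restr (lev x) (seqn x) = seqn x.
Proof. by have [] := level_branch HL (anodeP x). Qed.

Lemma anode_intro a y : L a y -> exists x : anode, lev x = a /\ seqn x = y.
Proof. by move=> Ly; exists (exist _ (a, y) Ly). Qed.

Lemma alt_strict : strict_order alt.
Proof.
split=> [x [/lt_irr]//|x y z [xy xE] [yz yE]]; split; first exact: lt_trans yz.
by rewrite -xE -yE restr_restr//; exact: ltW.
Qed.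

Lemma alt_below x y z : alt x z -> alt y z -> lt (lev x) (lev y) -> alt x y.
Proof.
move=> [xz xE] [yz yE] xy; split=> //.
by rewrite -yE -xE restr_restr//; exact: ltW.
Qed.

Lemma alt_wo x : well_orders alt [set y | alt y x].
Proof.
split=> [y z /= yx zx|B Bx [z Bz]].
  have [[yz|yz]|zy] := le_or_lt (lev y) (lev z).
  - apply: Or32; apply: anode_eq => //.
    by have [_ <-] := yx; have [_ <-] := zx; rewrite yz.
  - by apply: Or31; exact: alt_below zx yz.
  - by apply: Or33; exact: alt_below yx zy.
have [m [y By ym] mmin] := @lt_min (lev @` B) (ex_intro _ _ (imageP lev Bz)).
exists y => // y' By'; have [yy'|yy'] := mmin _ (imageP lev By').
  left; apply: anode_eq; first by rewrite ym.
  by have [_ <-] := Bx _ By; have [_ <-] := Bx _ By'; rewrite ym yy'.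
by right; apply: alt_below (Bx _ By) (Bx _ By') _; rewrite ym.
Qed.

Variable root : anode.
Hypothesis rootP : forall x, root = x \/ alt root x.

Definition affine_tree : tree := Tree alt_strict alt_wo rootP.
Local Notation T := affine_tree.
Implicit Types x y z : T.

Lemma tleP x y :
  tle x y <-> le (lev x) (lev y) /\ restr (lev x) (seqn y) = seqn x.
Proof.
split=> [[->|[xy xE]]|[[xy|xy] xE]].
- by split; [exact: le_refl|exact: seqn_supp].
- by split=> //; exact: ltW.
- by left; apply: anode_eq => //; rewrite -xE xy seqn_supp.
- by right; split.
Qed.

Lemma tle_trans x y z : tle x y -> tle y z -> tle x z.
Proof. by move=> xy yz; exact: tge_trans yz xy. Qed.

Lemma tle_lev x y : tle x y -> le (lev x) (lev y).
Proof. by move=> /tleP[]. Qed.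

Lemma tle_below x y z : tle x z -> tle y z -> le (lev x) (lev y) -> tle x y.
Proof.
move=> /tleP[_ xE] /tleP[_ yE] xy; apply/tleP; split=> //.
by rewrite -yE restr_restr.
Qed.

Lemma tle_below_eq x y z : tle x z -> tle y z -> lev x = lev y -> x = y.
Proof.
move=> /tleP[_ xE] /tleP[_ yE] xy; apply: anode_eq => //.
by rewrite -xE -yE xy.
Qed.

Lemma common_above x y z : tle x z -> tle y z -> tcomparable x y.
Proof.
move=> xz yz; have [xy|/ltW yx] := le_or_lt (lev x) (lev y).
  by left; exact: tle_below yz xy.
by right; exact: tle_below xz yx.
Qed.

Lemma comparable_lev x y : tcomparable x y -> le (lev x) (lev y) -> tle x y.
Proof.
move=> [//|yx] xy; left; apply: (@tle_below_eq x y x (tle_refl x) yx).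
by apply: le_anti => //; exact: tle_lev.
Qed.

Lemma up_at x a : le (lev x) a -> exists y, tle x y /\ lev y = a.
Proof.
move=> [<-|xa]; first by exists x; split=> //; exact: tle_refl.
have [u Lu uE] := level_ext HL xa (anodeP x).
have [y [ya yu]] := anode_intro Lu.
by exists y; split=> //; apply/tleP; rewrite ya yu; split=> //; right.
Qed.

Lemma up x a : exists y, tle x y /\ le a (lev y).
Proof.
have [b [xb ab]] := le_max (lev x) a.
by have [y [xy yb]] := up_at xb; exists y; rewrite yb.
Qed.

Lemma down x a : le a (lev x) ->
  exists y, [/\ tle y x, lev y = a & seqn y = restr a (seqn x)].
Proof.
move=> [->|ax].
  by exists x; split=> //; [exact: tle_refl|rewrite seqn_supp].
have [_ /(_ a ax)/anode_intro[y [ya yE]]] := level_branch HL (anodeP x).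
exists y; split=> //; apply/tleP; rewrite ya yE; split=> //; exact: ltW.
Qed.

Lemma split_above x : exists y z s,
  [/\ succ_of (lev x) s, lev y = s, lev z = s, y <> z & tle x y /\ tle x z].
Proof.
have [s sP] := succ_exists (lev x); have [xs _] := sP.
(* [u t] prolongs the sequence of [x] by the value [t]; the successor level contains all of these,
   and 0 and 1 give two. *)
pose u t : X := fun w => if pselect (w = lev x) then t else seqn x w.
have uE t : restr (lev x) (u t) = seqn x.
  rewrite -[RHS]seqn_supp; apply: restr_eq => w wx.
  by rewrite /u; case: pselect => // wx'; case: (@lt_irr w); rewrite {2}wx'.
have ux t : u t (lev x) = t by rewrite /u; case: pselect.
have Lu t : L s (u t).
  apply: (level_succ HL (succ_not_limit sP)); split.
    apply/funext => w; have [ws|ws] := pselect (lt w s).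
      by rewrite restr_in.
    rewrite restr_out// /u.
    case: pselect => [wx|nwx] /=; first by rewrite wx in ws.
    by rewrite -seqn_supp restr_out// => wx; apply: ws; exact: lt_trans xs.
  move=> b bs; have bx := succ_of_le sP bs.
  rewrite -(restr_restr _ bx) uE; case: bx => [->|bx].
    by rewrite seqn_supp; exact: anodeP.
  by have [_] := level_branch HL (anodeP x); apply.
have above t : exists y, [/\ lev y = s, seqn y = u t & tle x y].
  have [y [ys yE]] := anode_intro (Lu t); exists y; split=> //.
  by apply/tleP; rewrite ys yE; split=> //; exact: ltW.
have [y [ys yE xy]] := above 0; have [z [zs zE xz]] := above 1.
exists y, z, s; split=> // yz.
have := ux 1; rewrite -zE -yz yE ux => /esym/eqP.
by rewrite oner_eq0.
Qed.

(** [lev] is an isomorphism from the predecessors of [x] onto an initial segment, and any other such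
    isomorphism agrees with it by induction on the level. *)
Lemma on_levelP x a : on_level lt x a <-> lev x = a.
Proof.
split=> [[f [fmono fim]]|<-]; last first.
  exists lev; split.
    move=> y z yx zx; split=> [[]//|yz].
    exact: alt_below zx yz.
  apply/seteqP; split=> [_ [y [yx _] <-]//|b bx].
  have [y [yx yb _]] := down (ltW bx); exists y => //.
  by case: yx => // yx; move: bx; rewrite -yb yx => /lt_irr.
have node_at b : lt b (lev x) -> exists2 y, tlt y x & lev y = b.
  move=> bx; have [y [[yx|yx] yb _]] := down (ltW bx); last by exists y.
  by move: bx; rewrite -yb yx => /lt_irr.
have fa y : tlt y x -> lt (f y) a.
  move=> yx; suff : (f @` [set y | tlt y x]) (f y) by rewrite fim.
  by exists y.
have fE b y : tlt y x -> lev y = b -> f y = b.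
  elim/(well_founded_ind lt_wf): b y => b IHb y yx yb.
  have [[//|fyb]|bfy] := le_or_lt (f y) b.
    have [|z zx zE] := node_at (f y).
      by apply: lt_trans fyb _; rewrite -yb; case: yx.
    have fz := IHb _ fyb z zx zE.
    have : tlt z y by apply: alt_below zx yx _; rewrite zE yb.
    by move/(fmono _ _ zx yx); rewrite fz => /lt_irr.
  have [z zx zE] : (f @` [set y | tlt y x]) b.
    by rewrite fim; apply: lt_trans bfy _; exact: fa.
  have /(fmono _ _ zx yx)[zy _] : lt (f z) (f y) by rewrite zE.
  rewrite yb in zy; have := IHb _ zy z zx erefl; rewrite zE => bz.
  by move: zy; rewrite -bz => /lt_irr.
apply: le_anti.
  have [//|ax] := le_or_lt (lev x) a.
  have [y yx ya] := node_at a ax.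
  by have := fa y yx; rewrite (fE a)// => /lt_irr.
have [//|xa] := le_or_lt a (lev x).
have [y yx yE] : (f @` [set y | tlt y x]) (lev x) by rewrite fim.
by move: (yx) => -[+ _]; rewrite -(fE (lev y) y)// yE => /lt_irr.
Qed.

Lemma tlt_lev x y : tle x y -> lt (lev x) (lev y) -> tlt x y.
Proof. by move=> [->/lt_irr|]. Qed.

Lemma countable_level a : countable [set x : T | lev x = a].
Proof.
have /countable_injP[f finj] := level_count HL a.
apply/countable_injP; exists (f \o seqn) => x y.
move=> /set_mem /= xa /set_mem /= ya fxy.
apply: anode_eq; first by rewrite xa ya.
by apply: finj => //; apply/mem_set; [rewrite -xa|rewrite -ya]; exact: anodeP.
Qed.

Lemma affine_tree_normal : normal_omega1_tree lt T.
Proof.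
split.
- by move=> x; exists (lev x); exact/on_levelP.
- move=> a; have [u Lu] := level_nonempty HL a.
  by have [x [xa _]] := anode_intro Lu; exists x; exact/on_levelP.
- move=> a; apply: countable_sub (countable_level a) => x /=.
  by move/on_levelP.
- move=> x; have [y [z [s [sP ys zs yz [xy xz]]]]] := split_above x.
  have imm v : tle x v -> lev v = s -> immediate_succ x v.
    have [xs _] := sP.
    move=> xv vs; split; first by apply: tlt_lev; rewrite ?vs.
    move=> [w [xw _] [wv _]]; rewrite vs in wv.
    exact: le_nlt (succ_of_le sP wv) xw.
  by exists y, z; split=> //; exact: imm.
- move=> a x y [_ lima] /on_levelP xa /on_levelP ya xy.
  apply: anode_eq; first by rewrite xa ya.
  apply/funext => w; have [wa|wa] := pselect (lt w a); last first.
    by rewrite -(seqn_supp x) -(seqn_supp y) xa ya !restr_out.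
  (* The node on an intermediate level [b], a predecessor of both [x] and [y], already carries the
     value at [w]. *)
  have [b wb ba] := lima w wa.
  have bx : le b (lev x) by rewrite xa; exact: ltW.
  have [z [zx zb _]] := down bx.
  have zx' : tlt z x by apply: tlt_lev; rewrite ?zb ?xa.
  have [_ zx2] := zx'.
  have : [set z | tlt z x] z by [].
  rewrite xy => -[_ zy].
  by rewrite (restr_eqP zx2) ?(restr_eqP zy) ?zb.
- move=> a b x /on_levelP xa ab.
  have [|y [xy yb]] := @up_at x b; first by rewrite xa; exact: ltW.
  exists y; last exact/on_levelP.
  by apply: tlt_lev; rewrite // yb xa.
Qed.

(** * Sealing in the tree and the Souslin property *)

Lemma tree_seal (E : T -> T -> Prop) a0 :
  (forall x y, lev x = lev y -> exists x' y',
    [/\ tle x x', tle y y', lev x' = lev y' & E x' y']) ->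
  exists l, [/\ limit_ordinal lt l, lt a0 l &
    forall x y, lev x = l -> lev y = l -> x <> y ->
      exists x' y', [/\ tle x' x, tle y' y, lev x' = lev y', lt (lev x') l &
        E x' y']].
Proof.
move=> dn.
pose E' d u v := exists x y,
  [/\ lev x = d, lev y = d, seqn x = u, seqn y = v & E x y].
have [|l [liml a0l seal]] := level_seal HL (E := E') a0.
  move=> d u v /anode_intro[x [xd xu]] /anode_intro[y [yd yv]].
  have [|x' [y' [xx' yy' xy' Exy]]] := dn x y; first by rewrite xd yd.
  exists (lev x'), (seqn x'), (seqn y').
  have [xx1 xx2] := (tleP _ _).1 xx'; have [yy1 yy2] := (tleP _ _).1 yy'.
  rewrite -xd -xu -yv; split; split=> //.
  - exact: anodeP.
  - by rewrite xy'; exact: anodeP.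
  - by rewrite xd -yd.
  - by exists x', y'.
exists l; split=> // x y xl yl xy.
have [|||b bl [x' [y' [x'b y'b x'E y'E Exy]]]] := seal (seqn x) (seqn y).
- by rewrite -xl; exact: anodeP.
- by rewrite -yl; exact: anodeP.
- by move=> xy'; apply: xy; apply: anode_eq; rewrite // xl yl.
exists x', y'; split=> //; last by rewrite x'b.
- by apply/tleP; rewrite x'b x'E xl; split=> //; right.
- by apply/tleP; rewrite y'b y'E yl; split=> //; right.
- by rewrite x'b y'b.
Qed.

Lemma countable_levels_le a : countable [set x : T | le (lev x) a].
Proof.
apply: (@countable_sub _ _
  (\bigcup_(b in [set b | le b a]) [set x : T | lev x = b])).
  by move=> x xa; exists (lev x).
apply: bigcup_countable => [|b _]; first exact: countable_le.
exact: countable_level.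
Qed.

(** Sealed are the pairs whose first node extends a member of [A] or is incomparable with all of
    [A]. A member of [A] above level [l] would have such a node as a predecessor, which both cases
    exclude; so [A] lies on the countably many levels up to [l]. *)
Lemma affine_tree_souslin : souslin lt T.
Proof.
split=> [|A acA]; first exact: affine_tree_normal.
pose E x (_ : T) :=
  (exists2 p, A p & tle p x) \/ forall p, A p -> ~ tcomparable p x.
have [|l [_ rl seal]] := @tree_seal E (lev root).
  move=> x y xy.
  have [[a [Aa ax]]|na] := pselect (exists p, A p /\ tcomparable p x).
    have [x' [xx' ax']] : exists x', tle x x' /\ tle a x'.
      by case: ax => ax; [exists x|exists a]; split=> //; exact: tle_refl.
    have [y' [yy' y'x']] : exists y', tle y y' /\ lev y' = lev x'.
      by apply: up_at; rewrite -xy; exact: tle_lev.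
    by exists x', y'; split=> //; left; exists a.
  exists x, y; split; rewrite //; try exact: tle_refl.
  by right=> a Aa ax; apply: na; exists a.
apply: countable_sub (countable_levels_le l) => a Aa /=.
have [//|la] := le_or_lt (lev a) l.
have [c [ca cl _]] := down (ltW la).
(* Sealing speaks of distinct nodes, so [c] needs a partner: of two incompatible extensions of the
   root to level [l], one differs from [c]. *)
have [d [dl cd]] : exists x, lev x = l /\ c <> x.
  have [y [z [s [[rs smin] ys zs yz _]]]] := split_above root.
  have sl := smin _ rl.
  have [y' [yy' y'l]] : exists y', tle y y' /\ lev y' = l.
    by apply: up_at; rewrite ys.
  have [z' [zz' z'l]] : exists z', tle z z' /\ lev z' = l.
    by apply: up_at; rewrite zs.
  have [cy'|] := pselect (c = y'); last by exists y'.
  exists z'; split=> // cz'; apply: yz.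
  apply: tle_below_eq yy' _ _; last by rewrite ys.
  by rewrite -cy' cz'.
have [x' [y' [x'c _ _ x'l [[a' Aa' a'x']|na]]]] := seal c d cl dl cd.
  have a'a : tle a' a by apply: tle_trans ca; exact: tle_trans x'c.
  have [e|ne] := pselect (a' = a).
    exfalso; apply: le_nlt (tle_lev a'x') _; rewrite e; exact: lt_trans la.
  by case: (acA a' a Aa' Aa ne); left.
by case: (na a Aa); right; apply: tle_trans ca.
Qed.

(** * Forcing with the tree *)

Local Notation Q := (tree_forcing T).

(** The canonical name of the generic branch: each node is put in by itself as a condition. *)
Definition generic_name : name Q T := [set xs | xs.1 = xs.2].

Lemma fmem_generic x p : tle x p -> fmem x generic_name p.
Proof.
move=> xp q pq; exists q; first exact: tle_refl.
by exists x => //; exact: tle_trans pq.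
Qed.

Lemma fmem_generic_compat x p q : fmem x generic_name p -> tle p q ->
  exists r, tle q r /\ tle x r.
Proof.
move=> h pq; have [r qr [s xs sr]] := h q pq.
by exists r; rewrite (xs : x = s).
Qed.

Lemma generic_cofinal p : fcofinal_branch lt generic_name p.
Proof.
split; [|split].
- move=> x y; apply: fimp_intro => q _ [xq yq]; exists q; first exact: tle_refl.
  have [r [qr xr]] := fmem_generic_compat xq (tle_refl q).
  have [t [rt yt]] := fmem_generic_compat yq qr.
  by apply: common_above yt; exact: tle_trans rt.
- move=> x; apply: fimp_intro => q _ xc.
  have [r [qr xr]] := up q (lev x).
  exists r => //; apply: fmem_generic.
  have [t _ xrc] := fimp_elim (xc r) qr (fmem_generic (tle_refl r)).
  exact: comparable_lev.
- move=> a; apply: fex_intro => q _.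
  have [r [qr ar]] := up q a; have [x [xr xa _]] := down ar.
  exists x, r => //; split; first exact/on_levelP.
  exact: fmem_generic.
Qed.

(** If [B] were the branch, it would contain the successor [y] of [q], as [y] forces itself into the
    branch. But conditions above another successor [z] keep [y] out. *)
Lemma generic_new p : fnew generic_name p.
Proof.
move=> B q _ eqB.
have [y [z [s [_ ys zs yz [qy qz]]]]] := split_above q.
have [t _ /fmem_check By] := fimp_elim (eqB y).1 qy (fmem_generic (tle_refl y)).
have [r zr yr] := fimp_elim (eqB y).2 qz ((fmem_check _ _ _).2 By).
have [t' [rt yt]] := fmem_generic_compat yr (tle_refl r).
apply: yz; apply: tle_below_eq yt _ _; last by rewrite ys.
by apply: tle_trans rt; exact: zr.
Qed.

(** Otherwise every condition below [p] is comparable with all nodes it forces into [c]. Such nodes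
    enter the generic branch, and maximality of [c] gives the converse inclusion. *)
Lemma branch_off_generic (c : name Q T) p :
  fcofinal_branch lt c p -> (forall r, tle p r -> ~ feq c generic_name r) ->
  exists r y, [/\ tle p r, fmem y c r & ~ tcomparable y r].
Proof.
move=> [_ [cmax _]] neq; apply: contrapT => noff.
have comp r y : tle p r -> fmem y c r -> tcomparable y r.
  by move=> pr yr; apply: contrapT => nyr; apply: noff; exists r, y.
apply: (neq p (tle_refl p)) => x; split; apply: fimp_intro => q pq xq.
  exists q; first exact: tle_refl.
  move=> r qr; have pr : tle p r by exact: tle_trans qr.
  have [xr|rx] := comp r x pr (fmem_mono xq qr).
    by exists r; [exact: tle_refl|exists x].
  by exists x => //; exists x => //; exact: tle_refl.
have [r [qr xr]] := fmem_generic_compat xq (tle_refl q).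
have pr : tle p r by apply: tle_trans qr.
have xcomp : fall (fun y => fimp (fmem y c) (@fcheck Q (tcomparable x y))) r.
  move=> y; apply: fimp_intro => t rt yt; exists t; first exact: tle_refl.
  have xt : tle x t by exact: tle_trans rt.
  have [yt'|ty] := comp t y (tle_trans pr rt) yt.
    exact: common_above xt yt'.
  by left; exact: tle_trans ty.
have [t rt xt] := fimp_elim (cmax x) (pr : stronger (r : Q) p) xcomp.
by exists t => //; apply: tle_trans rt.
Qed.

(* Sealing at level [l] the pairs [(x, y)] such that [x] forces into [c] a node
   off [y] leaves no candidate for the node of [c] on level [l]. *)
Lemma unique_cofinal_branch (c : name Q T) p :
  fcofinal_branch lt c p -> exists2 r, tle p r & feq c generic_name r.
Proof.
move=> cb; apply: contrapT => neq.
have [|p1 [y0 [pp1 y0c y0p1]]] := branch_off_generic cb.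
  by move=> r pr cG; apply: neq; exists r.
have [chain [_ cof]] := cb.
have comparable_c q x y :
    tle p q -> fmem x c q -> fmem y c q -> tcomparable x y.
  by move=> pq xq yq; have [] := fimp_elim (chain x y) pq (conj xq yq).
(* The first two alternatives make [E] hold trivially away from [p1] and [y0], so density is at
   stake only for pairs above them. *)
pose E x y := [\/ ~ tcomparable p1 x, ~ tcomparable y0 y |
  exists z, [/\ fmem z c x, le (lev z) (lev x) & ~ tle z y]].
have [a [p1a y0a]] := le_max (lev p1) (lev y0).
have [|l [_ al seal]] := @tree_seal E a.
  move=> x y xy; have [b [xb ab]] := le_max (lev x) a.
  have yb : le (lev y) b by rewrite -xy.
  have [x1 [xx1 x1b]] := up_at xb; have [y1 [yy1 y1b]] := up_at yb.
  have [px1|px1] := pselect (tcomparable p1 x1); last first.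
    by exists x1, y1; split=> //; [rewrite x1b|exact: Or31].
  have [yy2|yy2] := pselect (tcomparable y0 y1); last first.
    by exists x1, y1; split=> //; [rewrite x1b|exact: Or32].
  have {}px1 : tle p1 x1.
    by apply: comparable_lev => //; rewrite x1b; exact: le_trans ab.
  (* One of two successors of [y1] differs from the node [z] of [c] on their level; moving to it
     leaves [z] off the second node. *)
  have [v [w [s [_ vs ws vw [yv yw]]]]] := split_above y1.
  have [z [r x1r [/on_levelP zs zr]]] :=
    fex_elim (cof s) (tle_trans pp1 px1 : stronger (x1 : Q) p).
  have [y2 [yy y2s zy2]] : exists y2, [/\ tle y1 y2, lev y2 = s & z <> y2].
    have [zv|] := pselect (z = v); last by exists v.
    by exists w; split=> //; rewrite zv.
  have [b' [rb' sb']] := le_max (lev r) s.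
  have [x3 [rx3 x3b]] := up_at rb'.
  have [y3 [y23 y3b]] : exists y3, tle y2 y3 /\ lev y3 = b'.
    by apply: up_at; rewrite y2s.
  exists x3, y3; split.
  - by apply: tle_trans xx1 _; apply: tle_trans rx3.
  - by apply: tle_trans yy1 _; apply: tle_trans y23.
  - by rewrite x3b.
  - apply: Or33; exists z; split; first by apply: (@fmem_mono Q) zr _.
      by rewrite zs x3b.
    by move=> zy3; apply: zy2; apply: tle_below_eq zy3 y23 _; rewrite zs.
(* For the contradiction, a node [x] above [p1] is paired with the node [y] of [c] on level [l],
   decided by some [r] above [x]. They differ because [y] extends [y0], which is incomparable with
   [p1]. *)
have p1l : le (lev p1) l by right; exact: le_lt_trans al.
have [x [p1x xl]] := up_at p1l.
have px : tle p x by exact: tle_trans p1x.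
have [y [r xr [/on_levelP yl yr]]] :=
  fex_elim (cof l) (px : stronger (x : Q) p).
have pr : tle p r by exact: tle_trans xr.
have y0r : fmem y0 c r.
  by apply: (@fmem_mono Q) y0c _; exact: tle_trans xr.
have y0y : tle y0 y.
  apply: comparable_lev; first exact: comparable_c yr.
  by rewrite yl; right; exact: le_lt_trans al.
have xy : x <> y.
  by move=> xy; apply: y0p1; apply: common_above p1x; rewrite xy.
have [x' [y' [x'x y'y x'y' x'l Exy]]] := seal x y xl yl xy.
case: Exy => [||[z [zx' zlev nzy']]].
- by apply; exact: common_above x'x.
- by apply; exact: common_above y'y.
(* Both [z] and [y] are forced into [c] by [r], so [z] lies below [y] and, by its level, below
   [y']. *)
- apply: nzy'; apply: tle_below y'y _; last by rewrite -x'y'.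
  apply: comparable_lev.
    apply: comparable_c yr => //; apply: (@fmem_mono Q) zx' _.
    exact: tle_trans xr.
  by rewrite yl; right; exact: le_lt_trans x'l.
Qed.

Lemma affine_tree_unique_branch : unique_branch_property lt T.
Proof.
apply: fex_intro => q _; exists generic_name, q; first exact: tle_refl.
split; first by split; [exact: generic_cofinal|exact: generic_new].
by move=> c; apply: fimp_intro => r _ [cb _]; exact: unique_cofinal_branch.
Qed.

(** * Point reflections along the generic branch *)

Hypothesis two_neq0 : 2%:R != 0 :> F.

(** The reflection [y = 2 s - x], in a form symmetric in [x] and [y]. *)
Definition reflected (s x y : T) :=
  [/\ lev x = lev s, lev y = lev s &
    forall w, seqn x w + seqn y w = 2%:R * seqn s w].

(** Evaluated in the extension, this is the union of the reflections centred at the nodes of the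
    generic branch, one for each level. *)
Definition reflection_name : name Q (T * T) :=
  [set xys | reflected xys.2 xys.1.1 xys.1.2].

Lemma reflected_sym s x y : reflected s x y -> reflected s y x.
Proof. by move=> [xs ys xy]; split=> // w; rewrite addrC. Qed.

Lemma reflected_inj s x y z : reflected s x y -> reflected s x z -> y = z.
Proof.
move=> [_ ys xy] [_ zs xz]; apply: anode_eq; first by rewrite ys zs.
by apply/funext => w; apply: (addrI (seqn x w)); rewrite xy xz.
Qed.

Lemma reflected_exists s x : lev x = lev s -> exists y, reflected s x y.
Proof.
move=> xs; have Lx : L (lev s) (seqn x) by rewrite -xs; exact: anodeP.
have [y [ys yE]] := anode_intro (level_affine HL 1 (anodeP s) (anodeP s) Lx).
by exists y; split=> // w; rewrite yE; ring.
Qed.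

(** Restriction is linear, so it carries the reflection in [s'] to the reflection in its restriction
    [s]. *)
Lemma reflected_tlt s s' x x' y y' : tle s s' ->
  reflected s x y -> reflected s' x' y' -> tlt x x' -> tlt y y'.
Proof.
move=> /tleP[_ sE] [xs ys xy] [xs' ys' xy'] [lxx' xE]; split.
  by rewrite ys ys' -xs -xs'.
rewrite -[RHS]seqn_supp; apply: restr_eq => w; rewrite ys => ws.
apply: (addrI (seqn x w)); rewrite xy -(restr_eqP sE ws) -xy'; congr (_ + _).
by rewrite (restr_eqP xE)// xs.
Qed.

Lemma fmem_reflection s x y p : tle s p -> reflected s x y ->
  fmem (x, y) reflection_name p.
Proof.
move=> sp sxy q pq; exists q; first exact: tle_refl.
by exists s => //; exact: tle_trans pq.
Qed.

Lemma fmem_reflection_sym x y p :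
  fmem (x, y) reflection_name p -> fmem (y, x) reflection_name p.
Proof.
move=> h q pq; have [r qr [s sxy sr]] := h q pq.
by exists r => //; exists s => //; exact: reflected_sym.
Qed.

Lemma fmem_reflection2 x y x' y' p :
  fmem (x, y) reflection_name p -> fmem (x', y') reflection_name p ->
  exists r s s', [/\ tle s r, tle s' r, reflected s x y & reflected s' x' y'].
Proof.
move=> xy xy'; have [r pr [s sxy sr]] := xy p (tle_refl p).
have [t rt [s' sxy' st]] := xy' r pr.
by exists t, s, s'; split=> //; exact: tle_trans rt.
Qed.

Lemma reflection_total x p : exists y, exists2 r, tle p r &
  fmem (x, y) reflection_name r.
Proof.
have [r [pr xr]] := up p (lev x); have [s [sr sx _]] := down xr.
have [y sxy] := reflected_exists (esym sx).
by exists y, r => //; exact: fmem_reflection sxy.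
Qed.

Lemma reflection_functional x y z p : fmem (x, y) reflection_name p ->
  fmem (x, z) reflection_name p -> y = z.
Proof.
move=> xy xz; have [r [s [s' [sr s'r sxy s'xz]]]] := fmem_reflection2 xy xz.
have ss' : s = s'.
  by apply: tle_below_eq sr s'r _; have [<- _ _] := sxy; have [<- _ _] := s'xz.
by rewrite -ss' in s'xz; exact: reflected_inj sxy s'xz.
Qed.

Lemma reflection_tlt x y x' y' p : fmem (x, y) reflection_name p ->
  fmem (x', y') reflection_name p -> tlt x x' -> tlt y y'.
Proof.
move=> xy xy' xx'.
have [r [s [s' [sr s'r sxy sxy']]]] := fmem_reflection2 xy xy'.
have ss' : tle s s'.
  apply: tle_below sr s'r _.
  by have [<- _ _] := sxy; have [<- _ _] := sxy'; case: xx' => ? _; right.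
exact: reflected_tlt ss' sxy sxy' xx'.
Qed.

(** Reflections are involutions: surjectivity, injectivity and the backward order implication come
    from totality, functionality and the forward implication by swapping the pair. *)
Lemma reflection_automorphism p : fautomorphism reflection_name p.
Proof.
have here (A : Prop) (q : T) : A -> exists2 r : Q, stronger r q & A.
  by move=> hA; exists q => //; exact: tle_refl.
split; [|split; [|split; [|split]]].
- by move=> x; apply: fex_intro => q _; exact: reflection_total.
- move=> x y z; apply: fimp_intro => q _ [xy xz]; apply: here.
  exact: reflection_functional xy xz.
- move=> y; apply: fex_intro => q _.
  have [x [r qr yx]] := reflection_total y q.
  by exists x, r => //; exact: fmem_reflection_sym.
- move=> x y z; apply: fimp_intro => q _ [xz yz]; apply: here.
  exact: reflection_functional (fmem_reflection_sym xz)
    (fmem_reflection_sym yz).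
- move=> x x' y y'; apply: fimp_intro => q _ [xy xy'].
  exists q; first exact: tle_refl.
  apply: fiff_check; split; first exact: reflection_tlt xy xy'.
  exact: reflection_tlt (fmem_reflection_sym xy) (fmem_reflection_sym xy').
Qed.

(** Above [y], the centre on the level of [y] is [y] itself; fixing another node [z] of that level
    would give [2 z = 2 y]. *)
Lemma reflection_nontrivial p : fnot (ftrivial reflection_name) p.
Proof.
move=> q _ triv; have [y [z [s [_ ys zs yz [qy qz]]]]] := split_above q.
have [r yr [t [/= zt _ tE] tr]] := triv z y qy.
have ty : t = y by apply: tle_below_eq tr yr _; rewrite -zt zs.
apply: yz; apply: anode_eq; first by rewrite ys.
apply/funext => w; apply: (mulfI two_neq0).
by rewrite -ty -tE; ring.
Qed.

Lemma affine_tree_forced_nonrigid : one_forces (fnot (frigid T Q)).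
Proof.
move=> q _ rigid; apply: (rigid q (tle_refl q)); apply: fex_intro => r _.
exists reflection_name, r; first exact: tle_refl.
by split; [exact: reflection_automorphism|exact: reflection_nontrivial].
Qed.

End AffineTree.
End Omega1.

Theorem theorem3p13 (W : Type) (lt : W -> W -> Prop)
    (hW : is_omega1 lt) (hD : diamond lt) :
  exists T : tree,
    souslin lt T /\
    unique_branch_property lt T /\
    ~ absolutely_rigid T /\
    one_forces (fnot (frigid T (tree_forcing T))).
Proof.
(* The rationals are a countable field in which 2 is nonzero. *)
have [L HL] := sealed_levels_exist hW rat hD.
have [w0 _] := inhabited_omega1 hW.
have [m _ minm] := lt_min hW (ex_intro [set: W] w0 I).
have [u Lu] := level_nonempty HL m.
have [r [rm ru]] := anode_intro Lu.
(* The least level contains only the zero function, so its node is the root. *)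
have below0 x : restr lt m x = fun=> 0 :> rat.
  apply/funext => w; apply: restr_out => wm.
  exact: (le_nlt hW) (minm w I) wm.
have rP (x : anode L) : r = x \/ alt lt r x.
  have rE y : restr lt (lev r) y = seqn r.
    by rewrite -(seqn_supp HL r) rm !below0.
  have [mx|mx] := minm (lev x) I; last by right; split; [rewrite rm|exact: rE].
  left; apply: anode_eq; first by rewrite rm.
  by rewrite -(seqn_supp HL x) -mx -rm rE.
exists (affine_tree hW rP).
have two_neq0 : (2%:R != 0 :> rat)%R by rewrite Num.Theory.pnatr_eq0.
have nonrigid := @affine_tree_forced_nonrigid W lt hW rat L HL r rP two_neq0.
split; first exact: (affine_tree_souslin hW HL rP).
split; first exact: (affine_tree_unique_branch HL (rootP := rP)).
split=> //.
by move=> rigid; exact: (nonrigid _ (tle_refl _) rigid).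
Qed.
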